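(* Let $\mathrm{ex}^{\mathrm{lin}}_3(n, C_5)$ denote the maximum number of hyperedges in a $3$-uniform linear hypergraph on $n$ vertices that contains no (Berge) cycle $C_5$ of length $5$. Then $$\mathrm{ex}^{\mathrm{lin}}_3(n, C_5) = \frac{1}{3\sqrt{3}}\, n^{3/2} + O(n).$$
   Context: A hypergraph $H=(V,E)$ is $3$-uniform if every hyperedge is a $3$-element subset of $V$, and linear if any two distinct hyperedges share at most one vertex. A (Berge) cycle of length $k\ge 2$ in $H$ is an alternating sequence $v_1,h_1,v_2,h_2,\dots,v_k,h_k$ of distinct vertices $v_i$ and distinct hyperedges $h_i$ such that $v_i,v_{i+1}\in h_i$ for $1\le i\le k-1$ and $v_k,v_1\in h_k$. $H$ contains no $C_5$ means $H$ has no Berge cycle of length $5$ (any choice of the hyperedges is forbidden). *)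

(* Defs.v *)
From mathcomp Require Import all_boot.

Set Implicit Arguments.
Unset Strict Implicit.
Unset Printing Implicit Defensive.

(* A hypergraph on the vertex set V is given by its set E of hyperedges. *)

Definition uniform (V : finType) (r : nat) (E : {set {set V}}) : bool :=
  [forall e in E, #|e| == r].

Definition linear_hypergraph (V : finType) (E : {set {set V}}) : bool :=
  [forall e in E, forall f in E, (e != f) ==> (#|e :&: f| <= 1)].

(* Indices start at 0; ordS is the cyclic successor i |-> i.+1 mod k on 'I_k,
   so the last hyperedge of the cycle closes it up.  A cycle has k >= 2. *)
Definition is_berge_cycle (V : finType) (E : {set {set V}}) (k : nat)
    (v : 'I_k -> V) (h : 'I_k -> {set V}) : bool :=
  [&& 2 <= k, injectiveb v, injectiveb h
    & [forall i, [&& h i \in E, v i \in h i & v (ordS i) \in h i]]].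

Definition has_berge_cycle (V : finType) (E : {set {set V}}) (k : nat) : bool :=
  [exists v : {ffun 'I_k -> V}, exists h : {ffun 'I_k -> {set V}},
    is_berge_cycle E v h].

(* The empty hypergraph is always admissible, so this is a genuine maximum. *)
Definition ex_lin (r n k : nat) : nat :=
  \max_(E : {set {set 'I_n}} |
          [&& uniform r E, linear_hypergraph E & ~~ has_berge_cycle E k]) #|E|.

(* Main.v *)
(* Lower bound: take the points of the grid [t]^3 as hyperedges and its 3t^2
   axis-parallel lines as vertices, a point containing the three lines through
   it.  In a closed walk of length 5 whose consecutive steps have distinct
   directions, some direction occurs exactly once, which is impossible.

   Upper bound: write d for the degree, N(a) for the neighbourhood of a, and
   N2(a) for the vertices outside N(a) lying on a hyperedge that avoids a and
   meets N(a) exactly once.  C5-freeness makes the graph which those hyperedges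
   induce on N2(a) have at most as many edges as vertices; the same argument
   bounds the hyperedges avoiding a that meet N(a) at least twice by
   |N(a)| = 2 d(a).  Hence |N2(a)| >= sum_(x in N(a)) d(x) - 8 d(a).  For a
   hyperedge abc, a vertex lies in at most two of N2(a), N2(b), N2(c), with few
   exceptions in total.  Summing over the m hyperedges inside an n-set gives
     sum_a d(a) sum_(x in N(a)) d(x) <= 2nm + 12 sum_a d(a)^2,
   whose left-hand side is at least 2n(3m/n)^3 by AM-GM.  After deleting
   vertices of degree below sqrt(n/3)/4 + O(1), the last sum is of lower
   order. *)
Require Import Defs.
From mathcomp Require Import all_boot all_order all_algebra ring lra.
Import Order.TTheory GRing.Theory Num.Theory.

Set Implicit Arguments.
Unset Strict Implicit.
Unset Printing Implicit Defensive.

(** * Bounding edges by vertices through charging *)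

(* An edge with an endpoint of degree 1 is charged to it; any other edge gives
   half a unit to each of two endpoints. *)
Lemma card_edges_le_vertices (V : finType) (X : {set V}) (F : {set {set V}}) :
  (forall e, e \in F -> 2 <= #|e :&: X|) ->
  (forall v, v \in X ->
    #|[set e in F | (v \in e) &&
        [forall u in e :&: X, 1 < #|[set f in F | u \in f]|]]| <= 2) ->
  #|F| <= #|X|.
Proof.
move=> F2 X2.
pose pd e := ~~ [forall u in e :&: X, 1 < #|[set f in F | u \in f]|].
pose D u := #|[set f in F | u \in f]|.
(* Units are doubled to stay integral: a pendant hyperedge ([pd]) sends 2 to each of its endpoints
   of degree 1, any other sends 1 to each of its endpoints in [X]. *)
pose wt e u := if pd e then 2 * (D u <= 1) else 1.
rewrite -(leq_pmul2r (isT : 0 < 2)) -!sum_nat_const.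
apply: (@leq_trans (\sum_(e in F) \sum_(u in X | u \in e) wt e u)).
  apply: leq_sum => e eF; case Hpd: (pd e); last first.
    rewrite (eq_bigr (fun=> 1)) => [|u _]; last by rewrite /wt Hpd.
    rewrite sum1_card; apply: leq_trans (F2 e eF) _.
    by apply: subset_leq_card; apply/subsetP=> u; rewrite !inE andbC.
  move/forallPn: (Hpd) => [u]; rewrite negb_imply inE -andbA -leqNgt.
  move=> /and3P[ue uX Du].
  by rewrite (bigD1 u) /= ?uX ?ue // /wt Hpd /D Du muln1 leq_addr.
rewrite (exchange_big_dep (fun u => u \in X)) //=; last by move=> e u _ /andP[].
apply: leq_sum => u uX; rewrite (eq_bigl (fun e => e \in [set f in F | u \in f])); last first.
  by move=> e; rewrite inE uX.
case: (leqP (D u) 1) => Du.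
  apply: (@leq_trans (\sum_(e in [set f in F | u \in f]) 2)).
    by apply: leq_sum => e _; rewrite /wt Du; case: ifP.
  by rewrite sum_nat_const -{2}[2]mul1n leq_mul2r Du.
apply: leq_trans (X2 u uX).
rewrite -sum1_card big_mkcond [X in _ <= X]big_mkcond /=.
apply: leq_sum => e _; rewrite !inE /wt (leqNgt (D u) 1) Du /= muln0 /pd.
by case: (e \in F); case: (u \in e); case: (X in ~~ X).
Qed.

(** * Local structure around a vertex *)

Section C5free.
Variables (V : finType) (E : {set {set V}}).
Hypotheses (E3 : uniform 3 E) (Elin : linear_hypergraph E)
  (EC5 : ~~ has_berge_cycle E 5).

Definition deg (x : V) : nat := #|[set e in E | x \in e]|.

Definition nbr (a : V) : {set V} :=
  [set x | (x != a) && [exists e in E, (a \in e) && (x \in e)]].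

Lemma card_edge e : e \in E -> #|e| = 3.
Proof. by move=> eE; apply/eqP; move/forall_inP: E3; apply. Qed.

Lemma edge_eq e f x y : e \in E -> f \in E -> x != y ->
  x \in e -> y \in e -> x \in f -> y \in f -> e = f.
Proof.
move=> eE fE xy xe ye xf yf; apply/eqP/negPn/negP => ef.
move/forall_inP: Elin => /(_ e eE)/forall_inP/(_ f fE)/implyP/(_ ef).
rewrite leqNgt => /negP; apply; apply/card_gt1P; exists x, y.
by rewrite !inE xe ye xf yf.
Qed.

Lemma nbrP a x :
  reflect (x != a /\ exists e, [/\ e \in E, a \in e & x \in e]) (x \in nbr a).
Proof.
rewrite inE; apply: (iffP andP) => -[xa].
  by move=> /existsP[e /and3P[eE ae xe]]; split=> //; exists e.
by move=> [e [eE ae xe]]; split=> //; apply/existsP; exists e; rewrite eE ae.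
Qed.

(** Unrolled form of [EC5], in which all distinctness conditions reduce to [uniq] of explicit
    lists. *)
Lemma no_C5 (v0 v1 v2 v3 v4 : V) (h0 h1 h2 h3 h4 : {set V}) :
  uniq [:: v0; v1; v2; v3; v4] -> uniq [:: h0; h1; h2; h3; h4] ->
  all (mem E) [:: h0; h1; h2; h3; h4] ->
  [&& v0 \in h0, v1 \in h0, v1 \in h1, v2 \in h1 & v2 \in h2] ->
  [&& v3 \in h2, v3 \in h3, v4 \in h3, v4 \in h4 & v0 \in h4] -> False.
Proof.
move=> uv uh hE inc1 inc2; move/negP: EC5; apply.
pose v := [:: v0; v1; v2; v3; v4]; pose h := [:: h0; h1; h2; h3; h4].
apply/existsP; exists [ffun i : 'I_5 => nth v0 v i].
apply/existsP; exists [ffun i : 'I_5 => nth h0 h i].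
rewrite /is_berge_cycle /=; apply/and3P; split.
- apply/injectiveP => i j; rewrite !ffunE => /eqP.
  by rewrite nth_uniq // => /eqP/val_inj.
- apply/injectiveP => i j; rewrite !ffunE => /eqP.
  by rewrite nth_uniq // => /eqP/val_inj.
move: hE inc1 inc2 => /= /and5P[H0 H1 H2 H3 /andP[H4 _]].
move=> /and5P[? ? ? ? ?] /and5P[? ? ? ? ?].
by apply/forallP => -[[|[|[|[|[|//]]]]] Hi]; rewrite !ffunE /=; apply/and3P.
Qed.

(* Otherwise a, c, w, u, c' would be the vertices of a C5. *)
Lemma common_edge a e1 e2 f w u c c' :
  [&& e1 \in E, e2 \in E & f \in E] -> [&& a \notin e1, a \notin e2 & a \notin f] ->
  e2 != e1 -> f != e1 -> w != u -> w \in e1 -> u \in e1 ->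
  w \in e2 -> c \in e2 -> c != w -> u \in f -> c' \in f -> c' != u ->
  c \in nbr a -> c' \in nbr a ->
  exists g, [/\ g \in E, a \in g, c \in g & c' \in g].
Proof.
move=> /and3P[e1E e2E fE] /and3P[ae1 ae2 af] e21 fe1 wu we1 ue1 we2 ce2 cw uf c'f c'u.
move=> /nbrP[ca [g [gE ag cg]]] /nbrP[c'a [g' [g'E ag' c'g']]].
have [gg'|gg'] := eqVneq g g'; first by exists g; rewrite {4}gg'.
have [cc'|cc'] := eqVneq c c'; first by exists g; rewrite -cc'.
have ne (e e' : {set V}) : a \in e -> a \notin e' -> e != e'.
  by move=> ae; apply: contraNneq => <-.
have ne' x (e : {set V}) : a \notin e -> x \in e -> a != x.
  by move=> ae xe; apply: contraNneq ae => ->.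
have e2f : e2 != f.
  by apply: contraNneq fe1 => e2f; apply/eqP/(edge_eq _ _ wu) => //; rewrite -e2f.
have cu : c != u.
  by apply: contraNneq e21 => cu; apply/eqP/(edge_eq _ _ wu) => //; rewrite -cu.
have wc' : w != c'.
  by apply: contraNneq fe1 => wc; apply/eqP/(edge_eq _ _ wu) => //; rewrite wc.
exfalso.
apply: (@no_C5 a c w u c' g e2 e1 f g').
- rewrite /= !inE !negb_or cw cu cc' wu wc' (eq_sym u) c'u.
  by rewrite (ne' _ _ ae2 ce2) (ne' _ _ af c'f) (ne' _ _ ae1 we1) (ne' _ _ ae1 ue1).
- rewrite /= !inE !negb_or e21 e2f (eq_sym e1) fe1 gg' ![_ == g']eq_sym.
  by rewrite !(ne g) ?(ne g') // eq_sym.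
- by rewrite /= gE e2E e1E fE g'E.
- by rewrite ag cg ce2 we2.
- by rewrite ue1 uf c'f c'g'.
Qed.

(* Three non-pendant hyperedges of F at w would, by common_edge, have their
   neighbours of a on a single hyperedge through a, which is too small. *)
Lemma card_edges_le (a : V) (F : {set {set V}}) (X : {set V}) :
  F \subset [set e in E | a \notin e] ->
  (forall e, e \in F -> 2 <= #|e :&: X|) ->
  (forall e w, e \in F -> w \in e :&: X -> exists2 c, c \in e :&: nbr a & c != w) ->
  #|F| <= #|X|.
Proof.
move=> /subsetP FE FX Fc; apply: card_edges_le_vertices => // w wX.
rewrite leqNgt; apply/negP => /card_gt2P[e1 [e2 [e3 [[]]]]].
rewrite !inE => /and3P[F1 w1 /forall_inP P1] /and3P[F2 w2 /forall_inP P2].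
move=> /and3P[F3 w3 /forall_inP P3] [n12 n23 n31].
have FEE e : e \in F -> e \in E by move/FE; rewrite inE => /andP[].
have Fa e : e \in F -> a \notin e by move/FE; rewrite inE => /andP[].
have col e : e \in F -> w \in e -> exists c, [/\ c \in e, c \in nbr a & c != w].
  move=> eF we; have [|c] := Fc e w eF; first by rewrite inE we.
  by rewrite inE => /andP[]; exists c.
have [c1 [c1e c1a c1w]] := col _ F1 w1.
have [c2 [c2e c2a c2w]] := col _ F2 w2.
have [c3 [c3e c3a c3w]] := col _ F3 w3.
have cne e e' c c' : e \in F -> e' \in F -> w \in e -> w \in e' -> e != e' ->
    c \in e -> c' \in e' -> c != w -> c != c'.
  move=> eF eF' we we' ee' ce ce' cw; apply: contraNneq ee' => cc'.
  by apply/eqP; apply: (edge_eq _ _ cw) => //; rewrite ?cc' ?FEE.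
have [c12 c23 c13] : [/\ c1 != c2, c2 != c3 & c1 != c3].
  by split; [apply: (cne e1 e2)|apply: (cne e2 e3)|apply: (cne e1 e3)]; rewrite // eq_sym.
(* The other endpoint [u] of the non-pendant [e] lies on a further [k] in [F]. By [common_edge], its
   neighbour [c0] of [a] shares a hyperedge through [a] with [c] and one with [c']; linearity makes
   these two equal. *)
have tri e f g c c' : e \in F -> f \in F -> g \in F -> w \in e -> w \in f -> w \in g ->
    (forall u, u \in e :&: X -> 1 < #|[set f in F | u \in f]|) ->
    f != e -> g != e -> c \in f -> c' \in g -> c \in nbr a -> c' \in nbr a ->
    c != w -> c' != w -> exists k, [/\ k \in E, a \in k, c \in k & c' \in k].
  move=> eF fF gF we wf wg Pe fe ge cf c'g ca c'a cw c'w.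
  have [u [ue uX uw]] : exists u, [/\ u \in e, u \in X & u != w].
    have /card_gt1P[x [y [+ + xy]]] := FX e eF; rewrite !inE.
    move=> /andP[xe xX] /andP[ye yX]; have [xw|] := eqVneq x w; last by exists x.
    by exists y; rewrite -xw eq_sym.
  have ueX : u \in e :&: X by rewrite inE ue.
  have [k [kF uk ke]] : exists k, [/\ k \in F, u \in k & k != e].
    have /card_gt1P[x [y [+ + xy]]] := Pe u ueX; rewrite !inE.
    move=> /andP[xF ux] /andP[yF uy]; have [xe|] := eqVneq x e; last by exists x.
    by exists y; rewrite -xe eq_sym.
  have [c0] : exists2 c, c \in k :&: nbr a & c != u.
    by apply: Fc => //; rewrite inE uk.
  rewrite inE => /andP[c0k c0a] c0u.
  have wu : w != u by rewrite eq_sym.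
  have [q [qE aq cq c0q]] : exists q, [/\ q \in E, a \in q, c \in q & c0 \in q].
    by apply: (@common_edge a e f k w u); rewrite ?FEE ?Fa.
  have [r [rE ar c'r c0r]] : exists r, [/\ r \in E, a \in r, c' \in r & c0 \in r].
    by apply: (@common_edge a e g k w u); rewrite ?FEE ?Fa.
  exists q; split=> //.
  suff -> : q = r by [].
  by have /nbrP[c0a' _] := c0a; apply: (edge_eq _ _ c0a').
have [|k [kE ak c2k c3k]] :=
  tri e1 e2 e3 c2 c3 F1 F2 F3 w1 w2 w3 P1 _ n31 c2e c3e c2a c3a c2w c3w.
  by rewrite eq_sym.
have [|k' [kE' ak' c1k' c3k']] :=
  tri e2 e1 e3 c1 c3 F2 F1 F3 w2 w1 w3 P2 n12 _ c1e c3e c1a c3a c1w c3w.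
  by rewrite eq_sym.
have [c3a' _] := nbrP _ _ c3a; have [c1a' _] := nbrP _ _ c1a; have [c2a' _] := nbrP _ _ c2a.
have kk' : k = k' by apply: (edge_eq _ _ c3a').
have : #|[set a; c1; c2; c3]| <= #|k|.
  by apply: subset_leq_card; rewrite !subUset !sub1set ak kk' c1k' -kk' c2k c3k.
rewrite (card_edge kE) -!setUA !cardsU1 cards1 !inE !negb_or.
by rewrite c12 c13 c23 ![a == _]eq_sym c1a' c2a' c3a'.
Qed.

(** * Degree and neighbourhood counts *)

Lemma sum_deg (X : {set V}) (f : V -> nat) :
  \sum_(x in X) deg x * f x = \sum_(e in E) \sum_(x in e :&: X) f x.
Proof.
rewrite (exchange_big_dep (fun x => x \in X)) /=; last by move=> e x _; rewrite inE => /andP[].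
apply: eq_bigr => x xX; rewrite /deg -sum_nat_const; apply: eq_bigl => e.
by rewrite !inE xX andbT.
Qed.

Lemma nbr_sym x y : (x \in nbr y) = (y \in nbr x).
Proof.
by apply/nbrP/nbrP => -[xy [e [eE ye xe]]]; split; rewrite 1?eq_sym //; exists e.
Qed.

Lemma edge_nbr e x y : e \in E -> x \in e -> y \in e -> x != y -> x \in nbr y.
Proof. by move=> eE xe ye xy; apply/nbrP; split=> //; exists e. Qed.

(** By linearity the hyperedges through [a] are pairwise disjoint off [a], and each contributes two
    neighbours. *)
Lemma card_nbr a : #|nbr a| = 2 * deg a.
Proof.
rewrite mulnC /deg -sum_nat_const -sum1_card.
rewrite (eq_bigr (fun e : {set V} => \sum_(x in e :\ a) 1)) => [|e]; last first.
  rewrite inE => /andP[eE ae]; rewrite sum1_card.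
  by move: (card_edge eE); rewrite (cardsD1 a) ae => -[].
rewrite (exchange_big_dep (fun x => x \in nbr a)) /=; last first.
  move=> e x; rewrite !inE => /andP[eE ae] /andP[xa xe]; rewrite xa /=.
  by apply/existsP; exists e; rewrite eE ae.
apply: eq_bigr => x /nbrP[xa [e [eE ae xe]]].
rewrite (big_pred1 e) // => f; rewrite !inE xa /=.
apply/idP/eqP => [/andP[/andP[fE af] xf]|->]; last by rewrite eE ae.
exact: (edge_eq _ _ xa).
Qed.

(** * Second neighbourhoods *)

Definition simple_edges a : {set {set V}} :=
  [set e in E | (a \notin e) && (#|e :&: nbr a| == 1)].

Definition multiple_edges a : {set {set V}} :=
  [set e in E | (a \notin e) && (1 < #|e :&: nbr a|)].

Definition nbr2 a : {set V} :=
  [set w | (w \notin nbr a) && [exists e in simple_edges a, w \in e]].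

(** A simple hyperedge meets [nbr2 a] in its two vertices outside [nbr a]; its single vertex in
    [nbr a] differs from both, as [card_edges_le] demands. *)
Lemma card_simple_edges a : #|simple_edges a| <= #|nbr2 a|.
Proof.
have F e : e \in simple_edges a -> e :&: nbr2 a = e :\: nbr a.
  move=> eF; apply/setP => w; rewrite !inE; case we: (w \in e); rewrite ?andbF //=.
  by rewrite andbT andb_idr // => _; apply/existsP; exists e; rewrite eF.
apply: (@card_edges_le a).
- by apply/subsetP => e; rewrite !inE => /and3P[-> ->].
- move=> e eF; rewrite F //.
  move: eF; rewrite inE => /and3P[eE _ /eqP e1].
  by move: (card_edge eE); rewrite -(cardsID (nbr a) e) e1 add1n => -[->].
move=> e w eF; rewrite F // inE => /andP[wa we].
move: eF; rewrite inE => /and3P[_ _ /cards1P[c ec]].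
have ce : c \in e :&: nbr a by rewrite ec inE.
exists c => //; move: ce; rewrite inE => /andP[_ ca].
by apply: contraNneq wa => <-.
Qed.

(** Here [X] is [nbr a] itself: of two neighbours of [a] on the hyperedge, at least one differs from
    [w]. *)
Lemma card_multiple_edges a : #|multiple_edges a| <= 2 * deg a.
Proof.
rewrite -card_nbr; apply: (@card_edges_le a).
- by apply/subsetP => e; rewrite !inE => /and3P[-> ->].
- by move=> e; rewrite inE => /and3P[].
move=> e w; rewrite inE => /and3P[_ _ /card_gt1P[x [y [xe ye xy]]]] _.
have [xw|] := eqVneq x w; last by exists x.
by exists y => //; rewrite -xw eq_sym.
Qed.

(** The sum counts incidences with [nbr a]: 2 for a hyperedge through [a], 1 for a simple one, at
    most 3 for a multiple one. The 8 is 2 + 3 * 2. *)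
Lemma sum_deg_nbr a : \sum_(x in nbr a) deg x <= 8 * deg a + #|nbr2 a|.
Proof.
have -> : \sum_(x in nbr a) deg x = \sum_(e in E) #|e :&: nbr a|.
  under [RHS]eq_bigr do rewrite -sum1_card.
  by rewrite -(sum_deg (nbr a) (fun=> 1)); under [RHS]eq_bigr do rewrite muln1.
apply: (@leq_trans (\sum_(e in E) (2 * (a \in e) + (e \in simple_edges a)
    + 3 * (e \in multiple_edges a)))).
  apply: leq_sum => e eE; rewrite !inE eE /=.
  have [ae|ae] := boolP (a \in e); rewrite /= ?muln0 ?muln1 ?addn0 ?add0n.
    move: (card_edge eE); rewrite (cardsD1 a) ae => -[<-].
    apply: subset_leq_card; apply/subsetP => x; rewrite !inE.
    by move=> /andP[-> /andP[-> _]].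
  have le3 : #|e :&: nbr a| <= 3 by rewrite -(card_edge eE) subset_leq_card // subsetIl.
  by case: #|_| le3 => [|[|k]].
have sumE k l (P Q S : pred {set V}) : \sum_(e in E) (k * P e + Q e + l * S e) =
    k * #|[set e in E | P e]| + #|[set e in E | Q e]| + l * #|[set e in E | S e]|.
  have sum1 (P' : pred {set V}) : \sum_(e in E) P' e = #|[set e in E | P' e]|.
    rewrite -sum1_card [RHS]big_mkcond [LHS]big_mkcond /=.
    by apply: eq_bigr => e _; rewrite inE; case: (e \in E); case: (P' e).
  by rewrite !big_split -!big_distrr /= !sum1.
rewrite (sumE 2 3 (fun e => a \in e) (fun e => e \in simple_edges a)
  (fun e => e \in multiple_edges a)).
have -> : [set e in E | e \in simple_edges a] = simple_edges a.
  by apply/setP => e; rewrite !inE; case: (e \in E).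
have -> : [set e in E | e \in multiple_edges a] = multiple_edges a.
  by apply/setP => e; rewrite !inE; case: (e \in E).
rewrite addnAC leq_add ?card_simple_edges //.
apply: leq_trans (leq_add (leqnn _) (leq_mul (leqnn 3) (card_multiple_edges a))) _.
by rewrite mulnA -mulnDl.
Qed.

(* For two vertices a, b of e, the two-step paths from a to w and from b to w
   close up with e to a C5, unless they share their middle vertex or their last
   hyperedge.  The last hyperedge cannot be common to all three paths with three
   different middle vertices. *)
Lemma nbr2_common_edge e w : e \in E -> (forall a, a \in e -> w \in nbr2 a) ->
  exists2 x, e \in multiple_edges x & w \in nbr x.
Proof.
move=> eE wN.
have wa a : a \in e -> w \notin nbr a by move/wN; rewrite inE => /andP[].
have path a : a \in e -> exists x f g, [/\ [&& f \in E, a \notin f, w \in f & x \in f],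
    [&& g \in E, a \in g & x \in g] & [&& x \notin e, x != w & x != a]].
  move=> ae; move: (wN a ae); rewrite inE => /andP[wna /existsP[f /andP[]]].
  rewrite inE => /and3P[fE af /cards1P[x fx]] wf.
  have : x \in f :&: nbr a by rewrite fx inE.
  rewrite inE => /andP[xf xa]; have /nbrP[xa' [g [gE ag xg]]] := xa.
  have xw : x != w by apply: contraNneq wna => <-.
  exists x, f, g; split; apply/and3P; split=> //; first by rewrite wf.
  by apply/negP => /wa; rewrite (edge_nbr fE) // eq_sym.
have wne a : a \in e -> a != w.
  move=> ae; have [x [f [g [/and4P[_ af wf _] _ _]]]] := path a ae.
  by apply: contraNneq af => ->.
have we : w \notin e by apply/negP => we; move: (wne w we); rewrite eqxx.
have pair a b xa fa ga xb fb gb : a \in e -> b \in e -> a != b ->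
    [/\ [&& fa \in E, a \notin fa, w \in fa & xa \in fa],
    [&& ga \in E, a \in ga & xa \in ga] & [&& xa \notin e, xa != w & xa != a]] ->
    [/\ [&& fb \in E, b \notin fb, w \in fb & xb \in fb],
    [&& gb \in E, b \in gb & xb \in gb] & [&& xb \notin e, xb != w & xb != b]] ->
    fa != fb -> xa = xb.
  move=> ae be ab [/and4P[faE afa wfa xafa] /and3P[gaE aga xaga] /and3P[xae xaw xaa]].
  move=> [/and4P[fbE bfb wfb xbfb] /and3P[gbE bgb xbgb] /and3P[xbe xbw xbb]] fab.
  have wg c g : c \in e -> g \in E -> c \in g -> w \notin g.
    move=> ce gE cg; apply/negP => wg; move: (wa c ce).
    by rewrite (edge_nbr gE) // eq_sym wne.
  have ne (f g : {set V}) x : x \in f -> x \notin g -> f != g.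
    by move=> xf; apply: contraNneq => <-.
  have ne' x y : y \in e -> x \notin e -> x != y.
    by move=> ye; apply: contraNneq => ->.
  have nab : ga != gb.
    apply/eqP => gab; move/negP: xae; apply.
    by rewrite (edge_eq eE gaE ab) // gab.
  apply/eqP/negPn/negP => xab.
  apply: (@no_C5 a xa w xb b ga fa fb gb e).
  - rewrite /= !inE !negb_or xaw xab ab (eq_sym w xb) xbw xbb (eq_sym a xa) xaa.
    by rewrite (eq_sym w b) !wne // (eq_sym a xb) !ne'.
  - rewrite /= !inE !negb_or fab nab (eq_sym ga) (ne fa ga w) ?(wg a) //=.
    rewrite (eq_sym ga) (ne fb ga w) ?(wg a) // (ne ga e xa) //=.
    rewrite (ne fa gb w) ?(wg b) // (ne fa e w) // (ne fb gb w) ?(wg b) //.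
    by rewrite (ne fb e w) // (ne gb e xb).
  - by rewrite /= gaE faE fbE gbE eE.
  - by rewrite aga xaga xafa wfa.
  - by rewrite xbfb xbgb bgb be.
have multx a b x : a \in e -> b \in e -> a != b -> x \in nbr a -> x \in nbr b ->
    x \notin e -> e \in multiple_edges x.
  move=> ae be ab xa xb xe; rewrite inE eE xe /=; apply/card_gt1P; exists a, b.
  by rewrite in_setI in_setI ae be (nbr_sym a) (nbr_sym b).
have : 2 < #|e| by rewrite card_edge.
move=> /card_gt2P[a [b [c [[ae be ce] [ab bc ca]]]]].
have [xa [fa [ga Ha]]] := path a ae.
have [xb [fb [gb Hb]]] := path b be.
have [xc [fc [gc Hc]]] := path c ce.
have Hab := pair _ _ _ _ _ _ _ _ ae be ab Ha Hb.
have Hbc := pair _ _ _ _ _ _ _ _ be ce bc Hb Hc.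
have Hca := pair _ _ _ _ _ _ _ _ ce ae ca Hc Ha.
case: Ha => /and4P[faE afa wfa xafa] /and3P[gaE aga xaga] /and3P[xae xaw xaa].
case: Hb => /and4P[fbE bfb wfb xbfb] /and3P[gbE bgb xbgb] /and3P[xbe xbw xbb].
case: Hc => /and4P[fcE cfc wfc xcfc] /and3P[gcE cgc xcgc] /and3P[xce xcw xcc].
have : [|| xa == xb, xb == xc | xc == xa].
  apply/negPn/negP; rewrite !negb_or => /and3P[xab xbc xca].
  have eab : fa = fb by apply/eqP/negPn/negP => /Hab/eqP; apply/negP.
  have ebc : fb = fc by apply/eqP/negPn/negP => /Hbc/eqP; apply/negP.
  have : #|[set w; xa; xb; xc]| <= #|fa|.
    by apply: subset_leq_card; rewrite !subUset !sub1set wfa xafa eab xbfb ebc.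
  rewrite (card_edge faE) -!setUA !cardsU1 cards1 !inE !negb_or.
  by rewrite xab xbc (eq_sym xa xc) xca ![w == _]eq_sym xaw xbw xcw.
have wx x f : f \in E -> w \in f -> x \in f -> x != w -> w \in nbr x.
  by move=> fE wf xf xw; rewrite (edge_nbr fE) // eq_sym.
have na := edge_nbr gaE xaga aga xaa.
have nb := edge_nbr gbE xbgb bgb xbb.
have nc := edge_nbr gcE xcgc cgc xcc.
case/or3P => /eqP H.
- by exists xa; [apply: (multx a b); rewrite // H|exact: (wx _ fa)].
- by exists xb; [apply: (multx b c); rewrite // H|exact: (wx _ fb)].
- by exists xc; [apply: (multx c a); rewrite // H|exact: (wx _ fc)].
Qed.

Lemma nbr2_sub a (U : {set V}) : (forall e, e \in E -> e \subset U) -> nbr2 a \subset U.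
Proof.
move=> EU; apply/subsetP => w; rewrite inE => /andP[_ /existsP[e /andP[]]].
by rewrite inE => /andP[eE _]; apply/subsetP/EU.
Qed.

(** A vertex [w] lying in all three sets has its third unit charged to an [x] from
    [nbr2_common_edge]; as [w] is in [nbr x], each [x] is charged at most 2 d(x) times. *)
Lemma sum_nbr2 e (U : {set V}) : (forall e, e \in E -> e \subset U) -> e \in E ->
  \sum_(a in e) #|nbr2 a| <= 2 * #|U| + \sum_(x | e \in multiple_edges x) 2 * deg x.
Proof.
move=> EU eE.
under [X in _ + X]eq_bigr do rewrite -card_nbr -sum1_card.
under eq_bigr do rewrite -sum1_card.
rewrite (exchange_big_dep (fun w => w \in U)) /=; last first.
  by move=> a w _; apply/subsetP/nbr2_sub.
rewrite [X in _ + X](exchange_big_dep predT) //= mulnC -sum_nat_const.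
apply: (@leq_trans (\sum_(w in U) (2 + \sum_(x | (e \in multiple_edges x) && (w \in nbr x)) 1))).
  apply: leq_sum => w wU; rewrite sum1_card.
  have [/leq_trans|lt2] := leqP #|[pred a | (a \in e) && (w \in nbr2 a)]| 2.
    by apply; rewrite leq_addr.
  have le3 : #|[pred a | (a \in e) && (w \in nbr2 a)]| <= 3.
    by rewrite -(card_edge eE); apply: subset_leq_card; apply/subsetP => a /andP[].
  have [a ae|x ex wx] := nbr2_common_edge eE (w := w).
    have /subset_cardP H : #|[pred a | (a \in e) && (w \in nbr2 a)]| = #|e|.
      by rewrite card_edge //; apply/eqP; rewrite eqn_leq le3.
    have /H/(_ a) : [pred a | (a \in e) && (w \in nbr2 a)] \subset e.
      by apply/subsetP => b /andP[].
    by rewrite ae inE => /andP[].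
  by apply: leq_trans le3 _; rewrite (bigD1 x) ?ex.
rewrite big_split /= leq_add2l [X in X <= _]big_mkcond /=; apply: leq_sum => w _.
by case: ifP.
Qed.

(** * Upper bound on degree-weighted walks *)

Lemma walk3_le (U : {set V}) : (forall e, e \in E -> e \subset U) ->
  \sum_a deg a * \sum_(x in nbr a) deg x
    <= 2 * #|U| * #|E| + 12 * \sum_a deg a ^ 2.
Proof.
move=> EU.
apply: (@leq_trans (8 * (\sum_a deg a ^ 2) + \sum_a deg a * #|nbr2 a|)).
  rewrite [X in _ <= X + _]big_distrr -big_split; apply: leq_sum => a _.
  rewrite -mulnn; apply: leq_trans (leq_mul (leqnn _) (sum_deg_nbr a)) _.
  by rewrite mulnDr mulnCA.
(* 12 = 8 + 4: each [x] is charged 2 d(x) by each of its at most 2 d(x) multiple hyperedges. *)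
suff : \sum_a deg a * #|nbr2 a| <= 2 * #|U| * #|E| + 4 * \sum_a deg a ^ 2.
  move=> H; apply: leq_trans (leq_add (leqnn _) H) _.
  by rewrite addnCA leq_add2l -mulnDl.
have -> : \sum_a deg a * #|nbr2 a| = \sum_(e in E) \sum_(a in e) #|nbr2 a|.
  transitivity (\sum_(a in [set: V]) deg a * #|nbr2 a|).
    by apply: eq_bigl => a; rewrite inE.
  by rewrite sum_deg; apply: eq_bigr => e _; rewrite setIT.
apply: (@leq_trans (\sum_(e in E) (2 * #|U| + \sum_(x | e \in multiple_edges x) 2 * deg x))).
  by apply: leq_sum => e eE; apply: sum_nbr2.
rewrite big_split /= sum_nat_const mulnC leq_add2l.
rewrite (exchange_big_dep predT) // big_distrr; apply: leq_sum => x _.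
have -> : \sum_(e in E | e \in multiple_edges x) 2 * deg x
    = #|multiple_edges x| * (2 * deg x).
  by rewrite -sum_nat_const; apply: eq_bigl => e; rewrite !inE; case: (e \in E).
apply: leq_trans (leq_mul (card_multiple_edges x) (leqnn _)) _.
by rewrite mulnACA mulnn.
Qed.

Lemma deg_outside (U : {set V}) a :
  (forall e, e \in E -> e \subset U) -> a \notin U -> deg a = 0.
Proof.
move=> EU aU; apply/eqP; rewrite cards_eq0; apply/set0Pn => -[e].
by rewrite inE => /andP[/EU/subsetP H /H]; apply/negP.
Qed.

Lemma sum_deg_all : \sum_a deg a = 3 * #|E|.
Proof.
transitivity (\sum_(a in [set: V]) deg a * 1).
  by apply: eq_big => [a|a _]; rewrite ?inE ?muln1.
rewrite sum_deg mulnC -sum_nat_const; apply: eq_bigr => e eE.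
by rewrite setIT sum1_card card_edge.
Qed.

Lemma card_nbr_le (U : {set V}) a :
  (forall e, e \in E -> e \subset U) -> 2 * deg a <= #|U|.
Proof.
move=> EU; rewrite -card_nbr; apply: subset_leq_card; apply/subsetP => x.
by move=> /nbrP[_ [e [/EU/subsetP H _ /H]]].
Qed.

End C5free.

(** * Passing to sub-hypergraphs *)

Section Heredity.
Variables (V : finType) (E F : {set {set V}}).
Hypothesis FE : F \subset E.

Lemma uniform_sub r : uniform r E -> uniform r F.
Proof. by move=> /forall_inP H; apply/forall_inP => e /(subsetP FE)/H. Qed.

Lemma linear_hypergraph_sub : linear_hypergraph E -> linear_hypergraph F.
Proof.
move=> /forall_inP H; apply/forall_inP => e /(subsetP FE)/H/forall_inP He.
by apply/forall_inP => f /(subsetP FE)/He.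
Qed.

Lemma has_berge_cycle_sub k : has_berge_cycle F k -> has_berge_cycle E k.
Proof.
move=> /existsP[v /existsP[h /and4P[k2 vi hi /forallP H]]].
apply/existsP; exists v; apply/existsP; exists h; apply/and4P; split=> //.
by apply/forallP => i; case/and3P: (H i) => /(subsetP FE) -> -> ->.
Qed.

End Heredity.

(** * Lower bounds on degree-weighted walks *)

Local Open Scope ring_scope.

(* AM-GM for p q / l^2, l / p and l / q, whose product is 1. *)
Lemma weighted_amgm (R : realFieldType) (l p q : R) : 0 < l -> 0 < p -> 0 < q ->
  l ^+ 2 * (3 - l / p - l / q) <= p * q.
Proof.
move=> l0 p0 q0.
suff H : 3 * l ^+ 2 * (p * q) <= (p * q) ^+ 2 + l ^+ 3 * (p + q).
  rewrite -(ler_pM2r (mulr_gt0 p0 q0)).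
  have -> : l ^+ 2 * (3 - l / p - l / q) * (p * q) =
      3 * l ^+ 2 * (p * q) - l ^+ 3 * (p + q).
    by field; rewrite !gt_eqF.
  by rewrite lerBlDr -expr2.
have sq : 4 * (p * q) <= (p + q) ^+ 2 by have := sqr_ge0 (p - q); nra.
set r := p * q in sq *; set t := p + q in sq *.
have r0 : 0 < r by apply: mulr_gt0.
have t0 : 0 < t by apply: addr_gt0.
set L := l ^+ 2; have L0 : 0 < L by apply: exprn_gt0.
(* It remains to contradict (L - r)^2 (4 L - r) >= 0. *)
rewrite leNgt; apply/negP => H.
have H1 : l ^+ 3 * t < r * (3 * L - r) by lra.
have lt0 : 0 < l ^+ 3 * t by apply: mulr_gt0 => //; apply: exprn_gt0.
have r3 : 0 < 3 * L - r by rewrite -(pmulr_rgt0 _ r0); lra.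
(* Squaring turns l^3 into L^3, and t^2 >= 4 r then leaves an inequality in [L] and [r] alone. *)
have H2 : (l ^+ 3 * t) ^+ 2 < (r * (3 * L - r)) ^+ 2.
  by rewrite ltr_pXn2r // nnegrE ltW // mulr_gt0.
have H3 : L ^+ 3 * (4 * r) <= (l ^+ 3 * t) ^+ 2.
  have -> : (l ^+ 3 * t) ^+ 2 = L ^+ 3 * t ^+ 2 by rewrite /L; ring.
  by rewrite ler_pM2l // exprn_gt0.
have H4 : 4 * L ^+ 3 < r * (3 * L - r) ^+ 2.
  by rewrite -(ltr_pM2r r0); move: (le_lt_trans H3 H2); congr (_ < _); ring.
have : 0 <= (L - r) ^+ 2 * (4 * L - r).
  by apply: mulr_ge0; [exact: sqr_ge0|lra].
suff -> : (L - r) ^+ 2 * (4 * L - r) = 4 * L ^+ 3 - r * (3 * L - r) ^+ 2 by lra.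
by ring.
Qed.

Section WalkCount.
Variables (V : finType) (E : {set {set V}}) (U : {set V}).
Hypotheses (E3 : uniform 3 E) (Elin : linear_hypergraph E)
  (EU : forall e, e \in E -> e \subset U).
Variable R : realFieldType.

Let d a : R := (deg E a)%:R.

Lemma nbr_deg_gt0 a x : x \in nbr E a -> (0 < deg E a)%N && (0 < deg E x)%N.
Proof.
move=> /nbrP[_ [e [eE ae xe]]].
by apply/andP; split; apply/card_gt0P; exists e; rewrite inE eE.
Qed.

(** A vertex of degree d > 0 contributes 2d terms 1/d, hence 2; a vertex of degree 0, such as any
    outside [U], contributes an empty sum. *)
Lemma sum_nbr_inv_deg : \sum_a \sum_(x in nbr E a) (d a)^-1 <= 2 * #|U|%:R.
Proof.
rewrite mulrC -natrM -sum_nat_const natr_sum [X in _ <= X]big_mkcond.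
apply: ler_sum => a _; rewrite sumr_const card_nbr //.
have [aU|/(deg_outside EU) ->] := ifPn (a \in U); last by rewrite muln0 mulr0n.
have [->|d0] := posnP (deg E a); first by rewrite muln0 mulr0n ler0n.
by rewrite mulrnA -[_ *+ deg E a]mulr_natr mulrnAl mulVf // pnatr_eq0 -lt0n.
Qed.

(** [weighted_amgm] is summed over the 6m ordered adjacent pairs, with [l] = 3m/n the average
    degree. Both sums of reciprocals are at most 2n, which leaves l^2 (18m - 4ln) = 6m l^2 = 54 m^3
    / n^2. *)
Lemma walk3_ge : 54 * #|E|%:R ^+ 3 <=
  (\sum_a d a * \sum_(x in nbr E a) d x) * #|U|%:R ^+ 2.
Proof.
have [E0|E_gt0] := posnP #|E|.
  rewrite E0 expr0n /= mulr0; apply: mulr_ge0; last exact: exprn_ge0.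
  by apply: sumr_ge0 => a _; apply: mulr_ge0 => //; apply: sumr_ge0.
have U_gt0 : (0 < #|U|)%N.
  case/card_gt0P: (E_gt0) => e eE; apply: leq_trans (subset_leq_card (EU eE)).
  by rewrite (card_edge E3 eE).
set m : R := #|E|%:R; set n : R := #|U|%:R.
have m0 : 0 < m by rewrite ltr0n.
have n0 : 0 < n by rewrite ltr0n.
pose l := 3 * m / n; have l0 : 0 < l by rewrite /l divr_gt0 // mulr_gt0.
have W_ge : \sum_a \sum_(x in nbr E a) l ^+ 2 * (3 - l / d a - l / d x) <=
    \sum_a d a * \sum_(x in nbr E a) d x.
  apply: ler_sum => a _; rewrite mulr_sumr; apply: ler_sum => x /nbr_deg_gt0/andP[a0 x0].
  by apply: weighted_amgm => //; rewrite ltr0n.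
have sum3 : \sum_a \sum_(x in nbr E a) 3 = 18 * m.
  transitivity (\sum_a 6 * d a).
    apply: eq_bigr => a _; rewrite sumr_const card_nbr // mulrnA.
    by rewrite -[LHS]mulr_natr -mulrnA.
  by rewrite -mulr_sumr -natr_sum sum_deg_all // natrM mulrA -natrM.
have sumy : \sum_a \sum_(x in nbr E a) (d x)^-1 = \sum_a \sum_(x in nbr E a) (d a)^-1.
  rewrite (exchange_big_dep predT) //=.
  by apply: eq_bigr => a _; apply: eq_bigl => x; rewrite nbr_sym.
have : l ^+ 2 * (18 * m - 4 * l * n) <= \sum_a d a * \sum_(x in nbr E a) d x.
  apply: le_trans W_ge.
  under eq_bigr do rewrite -mulr_sumr !sumrB -!mulr_sumr.
  rewrite -mulr_sumr !sumrB -!mulr_sumr sum3 sumy ler_pM2l ?exprn_gt0 //.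
  by have := sum_nbr_inv_deg; rewrite -/n; nra.
move=> /(ler_wpM2r (exprn_ge0 2 (ltW n0))); apply: le_trans.
suff -> : l ^+ 2 * (18 * m - 4 * l * n) * n ^+ 2 = 54 * m ^+ 3 by [].
by rewrite /l; field; rewrite gt_eqF.
Qed.

Lemma sum_sqr_deg_le (s : R) : (forall a, a \in U -> s <= d a) ->
  2 * s * \sum_a d a ^+ 2 <= \sum_a d a * \sum_(x in nbr E a) d x.
Proof.
move=> sd; rewrite mulr_sumr; apply: ler_sum => a _.
rewrite expr2 mulrCA; apply: ler_wpM2l => //.
have -> : 2 * s * d a = \sum_(x in nbr E a) s.
  by rewrite sumr_const card_nbr // -[RHS]mulr_natr natrM mulrCA mulrA.
apply: ler_sum => x /nbrP[_ [e [/EU/subsetP H _ /H]]]; exact: sd.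
Qed.

End WalkCount.

(** * The upper bound by vertex deletion *)

(* To be read with s = sqrt(n/3), m the number of hyperedges, s/4 a lower bound
   on the degrees d(a), W = sum_a d(a) sum_(x in N(a)) d(x), S = sum_a d(a)^2. *)
Lemma edge_bound_contra (R : realFieldType) (s m W S : R) :
  25 <= s -> s ^+ 3 + 1000 * (3 * s ^+ 2) < m ->
  54 * m ^+ 3 <= W * (3 * s ^+ 2) ^+ 2 ->
  W <= 2 * (3 * s ^+ 2) * m + 12 * S ->
  2 * (s / 4) * S <= W -> False.
Proof.
move=> s25 mlb H1 H2 H3.
have s0 : 0 < s by lra.
have m0 : 0 < m by apply: le_lt_trans mlb; rewrite addr_ge0 // ?mulr_ge0 // ?exprn_ge0 // ltW.
(* Multiplying the upper bound on [W] by [s] allows 12 s S <= 24 W to be absorbed on the left. *)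
have H4 : W * (s - 24) <= 6 * s ^+ 3 * m.
  have := ler_wpM2l (ltW s0) H2.
  have -> : s * (2 * (3 * s ^+ 2) * m + 12 * S) =
    6 * s ^+ 3 * m + 24 * (2 * (s / 4) * S) by field.
  by move: H3; set X := 2 * (s / 4) * S; lra.
(* 54 m^3 (s - 24) <= 9 s^4 W (s - 24) <= 54 s^7 m. *)
have H5 : m ^+ 2 * (s - 24) <= s ^+ 7.
  rewrite -(ler_pM2l (_ : 0 < 54 * m)); last by apply: mulr_gt0.
  have s24 : 0 <= s - 24 by lra.
  have := ler_wpM2r s24 H1.
  have := ler_wpM2l (exprn_ge0 2 (_ : 0 <= 3 * s ^+ 2)) H4.
  move=> /(_ (mulr_ge0 _ (exprn_ge0 2 (ltW s0)))) /=.
  lra.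
have H6 : (s ^+ 2 * (s + 3000)) ^+ 2 <= m ^+ 2.
  have p0 : 0 <= s ^+ 2 * (s + 3000) by apply: mulr_ge0; [apply/exprn_ge0/ltW|lra].
  by apply: lerXn2r; rewrite ?nnegrE ?(ltW m0) //; lra.
have H7 : s ^+ 4 * ((s + 3000) ^+ 2 * (s - 24)) <= s ^+ 4 * s ^+ 3.
  rewrite -exprD; apply: le_trans H5.
  have -> : s ^+ 4 * ((s + 3000) ^+ 2 * (s - 24)) = (s ^+ 2 * (s + 3000)) ^+ 2 * (s - 24) by ring.
  by apply: ler_wpM2r => //; lra.
move: H7; rewrite ler_pM2l ?exprn_gt0 //; nra.
Qed.

(** With y^2 = x^2 + 1/3, y^3 - x^3 = x^2 (y - x) + y/3. This growth of the main term pays for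
    deleting a vertex of low degree. *)
Lemma sqrt_step (R : rcfType) n :
  Num.sqrt (n%:R / 3) ^+ 3 + Num.sqrt (n.+1%:R / 3) / 4
    <= Num.sqrt (n.+1%:R / 3) ^+ 3 :> R.
Proof.
pose s k : R := Num.sqrt (k%:R / 3); rewrite -!/(s _).
have sq k : s k ^+ 2 = k%:R / 3 by rewrite sqr_sqrtr // divr_ge0.
have s0 k : 0 <= s k by exact: sqrtr_ge0.
have : s n.+1 ^+ 2 = s n ^+ 2 + 1 / 3 by rewrite !sq -addn1 natrD mulrDl.
move: (s0 n) (s0 n.+1); set x := s n; set y := s n.+1 => x0 y0 Hxy.
have xy : x <= y by nra.
rewrite (exprSr y 2) Hxy (exprSr x 2).
have := mulr_ge0 (sqr_ge0 x) (_ : 0 <= y - x); rewrite subr_ge0 => /(_ xy).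
lra.
Qed.

(** Induction on the size of [U], a subset of a fixed type so that vertices can be removed. A vertex
    of degree at most s/4 + 1000 is deleted, [sqrt_step] covering s/4 and the linear term 1000; if
    there is none, the two walk bounds clash. *)
Lemma card_le_of_no_C5 (R : rcfType) (V : finType) (n : nat) (U : {set V}) (E : {set {set V}}) :
  #|U| = n -> (forall e, e \in E -> e \subset U) ->
  uniform 3 E -> linear_hypergraph E -> ~~ has_berge_cycle E 5 ->
  #|E|%:R <= Num.sqrt (n%:R / 3) ^+ 3 + 1000 * n%:R :> R.
Proof.
elim: n U E => [|n IH] U E Un EU E3 Elin EC5.
  have -> : E = set0.
    apply/setP => e; rewrite inE; apply/negP => eE.
    have := subset_leq_card (EU e eE); by rewrite Un (card_edge E3 eE).
  by rewrite cards0 mulr0 addr0 exprn_ge0 ?sqrtr_ge0.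
set s := Num.sqrt _.
have [/existsP[u /andP[uU du]]|] := boolP [exists u in U, (deg E u)%:R <= s / 4 + 1000].
  pose F := [set e in E | u \notin e].
  have FE : F \subset E by apply/subsetP => e; rewrite inE => /andP[].
  have -> : #|E| = (#|F| + deg E u)%N.
    rewrite -(cardsID F E) (setIidPr FE); congr (_ + _)%N.
    by apply: eq_card => e; rewrite !inE; case: (e \in E); rewrite ?andbF //= andbT negbK.
  have HF : #|F|%:R <= Num.sqrt (n%:R / 3) ^+ 3 + 1000 * n%:R :> R.
    apply: (IH (U :\ u)).
    - by move: Un; rewrite (cardsD1 u) uU => -[].
    - by move=> e; rewrite inE => /andP[/EU eU ue]; rewrite subsetD1 eU.
    - exact: uniform_sub E3.
    - exact: linear_hypergraph_sub Elin.
    - exact: contra (@has_berge_cycle_sub _ _ _ FE 5) EC5.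
  have := sqrt_step R n; rewrite /= -/s => Hs.
  by rewrite natrD -[n.+1]addn1 natrD; lra.
rewrite negb_exists => /forallP noU.
have Ud a : a \in U -> s / 4 + 1000 < (deg E a)%:R.
  by move=> aU; move: (noU a); rewrite aU /= -ltNge.
have s0 : 0 <= s by exact: sqrtr_ge0.
have s2 : n.+1%:R = 3 * s ^+ 2 by rewrite sqr_sqrtr ?divr_ge0 //; field.
(* 2 (s/4 + 1000) < 2 d(u) <= n = 3 s^2 forces s^2 > 625. *)
have s25 : 25 <= s.
  have /card_gt0P[u uU] : (0 < #|U|)%N by rewrite Un.
  have := card_nbr_le E3 Elin u EU.
  rewrite Un -(ler_nat R) natrM s2 => H.
  rewrite -(ler_pXn2r (isT : (0 < 2)%N)) ?nnegrE //.
  by have := Ud u uU; lra.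
rewrite leNgt; apply/negP => mlb.
apply: (@edge_bound_contra R s #|E|%:R
  (\sum_a (deg E a)%:R * \sum_(x in nbr E a) (deg E x)%:R) (\sum_a (deg E a)%:R ^+ 2)) => //.
- by rewrite -s2.
- by rewrite -s2 -Un; apply: walk3_ge.
- have := walk3_le E3 Elin EC5 EU; rewrite -(ler_nat R) Un natrD !natrM s2 !natr_sum.
  under eq_bigr do rewrite natrM natr_sum.
  by under [X in _ <= _ + _ * X]eq_bigr do rewrite natrX.
- by apply: (sum_sqr_deg_le E3 Elin EU) => a /Ud; lra.
Qed.

(** * The grid hypergraph *)

(* The line through p in direction d, given by d and the other coordinates. *)
Definition grid_line (t : nat) (d : 'I_3) (p : 'I_t * 'I_t * 'I_t) :
    'I_3 * ('I_t * 'I_t) :=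
  (d, if d == 0 then (p.1.2, p.2) else if d == 1 then (p.1.1, p.2) else p.1).

Section Grid.
Variables (t : nat) (V : finType) (phi : 'I_3 * ('I_t * 'I_t) -> V).
Hypothesis phi_inj : injective phi.

Definition grid_edge p : {set V} := [set phi (grid_line d p) | d : 'I_3].

Definition grid_edges : {set {set V}} := [set grid_edge p | p : 'I_t * 'I_t * 'I_t].

(** A line fixes the two coordinates other than its direction, so two directions fix all three. *)
Lemma grid_line_inj2 d e (p q : 'I_t * 'I_t * 'I_t) :
  d != e -> grid_line d p = grid_line d q -> grid_line e p = grid_line e q -> p = q.
Proof.
case: p q => [[x y] z] [[x' y'] z'].
by case: d => [[|[|[|//]]] ?]; case: e => [[|[|[|//]]] ?] // _ [? ?] [? ?]; congruence.
Qed.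

Lemma grid_edge_inter p q u v : u != v -> u \in grid_edge p -> v \in grid_edge p ->
  u \in grid_edge q -> v \in grid_edge q -> p = q.
Proof.
move=> uv /imsetP[d _ ud] /imsetP[e _ ve] /imsetP[d' _ ud'] /imsetP[e' _ ve'].
have Hd : grid_line d p = grid_line d' q by apply: phi_inj; rewrite -ud.
have He : grid_line e p = grid_line e' q by apply: phi_inj; rewrite -ve.
have dd : d = d' := congr1 fst Hd; have ee : e = e' := congr1 fst He.
rewrite -dd in Hd; rewrite -ee in He; apply: (grid_line_inj2 _ Hd He).
by apply: contraNneq uv => de; rewrite ud ve de.
Qed.

Lemma grid_line_dir_inj (p : 'I_t * 'I_t * 'I_t) :
  injective (fun d => phi (grid_line d p)).
Proof. by move=> d e /phi_inj[]. Qed.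

Lemma grid_uniform : uniform 3 grid_edges.
Proof.
apply/forall_inP => _ /imsetP[p _ ->].
by rewrite card_imset ?card_ord //; apply: grid_line_dir_inj.
Qed.

Lemma grid_linear : linear_hypergraph grid_edges.
Proof.
apply/forall_inP => _ /imsetP[p _ ->]; apply/forall_inP => _ /imsetP[q _ ->].
apply/implyP; rewrite leqNgt; apply: contra => /card_gt1P[u [v [+ + uv]]].
rewrite !in_setI => /andP[up uq] /andP[vp vq]; by rewrite (grid_edge_inter uv up vp uq vq).
Qed.

Lemma card_grid_edges : #|grid_edges| = (t ^ 3)%N.
Proof.
rewrite card_imset; first by rewrite !card_prod card_ord !expnS expn0 muln1 mulnA.
move=> p q pq; have mem d : phi (grid_line d p) \in grid_edge p by apply: imset_f.
apply: (@grid_edge_inter p q (phi (grid_line 0 p)) (phi (grid_line 1 p))); rewrite -?pq //.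
by apply/eqP => /grid_line_dir_inj.
Qed.

(** Among three directions, none cyclically repeated, each occurs at most twice in five steps, so
    one occurs exactly once. Its coordinate changes at no other step, so that step is trivial. *)
Lemma grid_closed5 (p0 p1 p2 p3 p4 : 'I_t * 'I_t * 'I_t) (d0 d1 d2 d3 d4 : 'I_3) :
  d0 != d1 -> d1 != d2 -> d2 != d3 -> d3 != d4 -> d4 != d0 ->
  grid_line d1 p0 = grid_line d1 p1 -> grid_line d2 p1 = grid_line d2 p2 ->
  grid_line d3 p2 = grid_line d3 p3 -> grid_line d4 p3 = grid_line d4 p4 ->
  grid_line d0 p4 = grid_line d0 p0 ->
  p0 = p1 \/ p1 = p2 \/ p2 = p3 \/ p3 = p4 \/ p4 = p0.
Proof.
case: p0 p1 p2 p3 p4 => [[x0 y0] z0] [[x1 y1] z1] [[x2 y2] z2] [[x3 y3] z3] [[x4 y4] z4].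
case: d0 => [[|[|[|//]]] ?]; case: d1 => [[|[|[|//]]] ?] //;
case: d2 => [[|[|[|//]]] ?] //; case: d3 => [[|[|[|//]]] ?] //;
case: d4 => [[|[|[|//]]] ?] // _ _ _ _ _ [? ?] [? ?] [? ?] [? ?] [? ?]; subst; tauto.
Qed.

Lemma grid_no_C5 : ~~ has_berge_cycle grid_edges 5.
Proof.
apply/existsP => -[v /existsP[h /and4P[_ /injectiveP vi /injectiveP hi /forallP H]]].
pose o k : 'I_5 := inord k.
have ox : exists p : 'I_5 -> 'I_t * 'I_t * 'I_t, forall i, h i = grid_edge (p i).
  have P i : exists p, h i == grid_edge p.
    by case/and3P: (H i) => /imsetP[p _ ->] _ _; exists p.
  by exists (fun i => xchoose (P i)) => i; apply/eqP; exact: (xchooseP (P i)).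
case: ox => p hp.
have dx : exists d : 'I_5 -> 'I_3, forall i, v i = phi (grid_line (d i) (p i)).
  have P i : exists d, v i == phi (grid_line d (p i)).
    by case/and3P: (H i) => _; rewrite hp => /imsetP[d _ ->] _; exists d.
  by exists (fun i => xchoose (P i)) => i; apply/eqP; exact: (xchooseP (P i)).
case: dx => d vd.
have step i : grid_line (d (ordS i)) (p i) = grid_line (d (ordS i)) (p (ordS i)).
  case/and3P: (H i) => _ _; rewrite hp => /imsetP[e _]; rewrite vd => /phi_inj E.
  by rewrite E (congr1 fst E : d (ordS i) = e).
have pne i : p i != p (ordS i).
  have : h i != h (ordS i) by rewrite (inj_eq hi); case: i => [[|[|[|[|[|]]]]] ?].
  by rewrite !hp; apply: contraNneq => ->.
(* Lines [v i] and [v (ordS i)] both pass through the point [p i], so equal directions would make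
   them equal. *)
have dne i : d i != d (ordS i).
  have : v i != v (ordS i) by rewrite (inj_eq vi); case: i => [[|[|[|[|[|]]]]] ?].
  by rewrite !vd; apply: contraNneq => E; rewrite E step.
have S k : (k < 5)%N -> ordS (o k) = o (k.+1 %% 5)%N.
  by move=> k5; apply: val_inj; rewrite /= !inordK // ltn_pmod.
have := (step (o 0), step (o 1), step (o 2), step (o 3), step (o 4)).
have := (pne (o 0), pne (o 1), pne (o 2), pne (o 3), pne (o 4)).
have := (dne (o 0), dne (o 1), dne (o 2), dne (o 3), dne (o 4)).
rewrite !S // => -[[[[D0 D1] D2] D3] D4] [[[[P0 P1] P2] P3] P4] [[[[L0 L1] L2] L3] L4].
by case: (grid_closed5 D0 D1 D2 D3 D4 L0 L1 L2 L3 L4) => [E|[E|[E|[E|E]]]];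
  move: P0 P1 P2 P3 P4; rewrite E eqxx.
Qed.

End Grid.

(** * Bounds on the extremal number *)

(** The 3t^2 grid lines are numbered into ['I_n]; the remaining vertices stay isolated. *)
Lemma ex_lin_ge n t : (3 * t ^ 2 <= n)%N -> (t ^ 3 <= ex_lin 3 n 5)%N.
Proof.
move=> tn.
have cW : (#|{: 'I_3 * ('I_t * 'I_t)}| <= n)%N by rewrite !card_prod !card_ord.
pose phi w := widen_ord cW (enum_rank w : 'I_#|{: 'I_3 * ('I_t * 'I_t)}|).
have phi_inj : injective phi.
  by move=> u w /(congr1 val) /= /val_inj /enum_rank_inj.
rewrite -(card_grid_edges phi_inj); apply: leq_bigmax_cond.
by rewrite grid_uniform // grid_linear // grid_no_C5.
Qed.

Lemma ex_lin_le (R : rcfType) n :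
  (ex_lin 3 n 5)%:R <= Num.sqrt (n%:R / 3) ^+ 3 + 1000 * n%:R :> R.
Proof.
apply: (@big_ind _ (fun k : nat => k%:R <= Num.sqrt (n%:R / 3) ^+ 3 + 1000 * n%:R :> R)).
- by rewrite mulr0n addr_ge0 ?exprn_ge0 ?sqrtr_ge0 ?mulr_ge0 ?ler0n.
- by move=> x y Hx Hy; rewrite /maxn; case: ifP.
move=> E /and3P[E3 Elin EC5].
by apply: (@card_le_of_no_C5 R _ n [set: 'I_n]); rewrite // cardsT card_ord.
Qed.

Lemma ex_lin_ge_sqrt (R : archiRcfType) n :
  Num.sqrt (n%:R / 3) ^+ 3 - n%:R <= (ex_lin 3 n 5)%:R :> R.
Proof.
set s := Num.sqrt _.
have s0 : 0 <= s by exact: sqrtr_ge0.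
have s2 : n%:R = 3 * s ^+ 2 by rewrite sqr_sqrtr ?divr_ge0 //; field.
(* The grid side is the integer part of s = sqrt(n/3), the largest [t] with 3t^2 <= n. *)
have /andP[ts st] := truncn_itv s0; set t := Num.truncn s in ts st.
have tn : (3 * t ^ 2 <= n)%N.
  by rewrite -(ler_nat R) natrM natrX s2 ler_pM2l // lerXn2r // nnegrE.
apply: le_trans (_ : (t ^ 3)%:R <= _); last by rewrite ler_nat ex_lin_ge.
rewrite natrX s2; move: st; rewrite -addn1 natrD => st.
have t0 : 0 <= t%:R :> R by [].
(* For s <= 1 the left side is nonpositive; otherwise s - 1 >= 0 and t^3 >= (s - 1)^3 >= s^3 - 3
   s^2. *)
have [s1|s1] := leP s 1.
  apply: le_trans (exprn_ge0 3 t0).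
  by rewrite exprS; have := sqr_ge0 s; nra.
apply: (@le_trans _ _ ((s - 1) ^+ 3)).
  have -> : (s - 1) ^+ 3 = s ^+ 3 - 3 * s ^+ 2 + (3 * s - 1) by ring.
  by lra.
by apply: lerXn2r; rewrite ?nnegrE //; lra.
Qed.

(* Asymptotic form *)
From mathcomp Require Import all_classical all_reals all_analysis.
Import numFieldNormedType.Exports.

Lemma main_term_sqrt (R : realType) n :
  1 / (3 * Num.sqrt 3) * n%:R `^ (3 / 2) = Num.sqrt (n%:R / 3) ^+ 3 :> R.
Proof.
have -> : 3 / 2 = 2^-1 * 3%:R :> R by field.
rewrite powRrM powR12_sqrt // powR_mulrn ?sqrtr_ge0 //.
rewrite sqrtrM // sqrtrV // exprMn mulrC; congr (_ * _).
rewrite exprVn div1r; congr (_^-1).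
by rewrite exprSr sqr_sqrtr.
Qed.

Local Open Scope classical_set_scope.
Local Open Scope ring_scope.

Theorem theorem1 (R : realType) :
  (fun n : nat => (ex_lin 3 n 5)%:R : R) =
    (fun n : nat => 1 / (3 * Num.sqrt 3) * n%:R `^ (3 / 2))
      +O_\oo (fun n : nat => n%:R : R).
Proof.
apply/eqaddOP; near=> k; near=> n.
rewrite /= !fctE main_term_sqrt [X in _ <= _ * X]ger0_norm //.
(* The error lies between -n and 1000 n, so 1000 serves on both sides. *)
apply: (@le_trans _ _ (1000 * n%:R)).
  rewrite ler_norml; apply/andP; split.
    by have := ex_lin_ge_sqrt R n; have : 0 <= n%:R :> R by []; lra.
  by rewrite lerBlDl ex_lin_le.
by apply: ler_wpM2r => //; near: k; apply: nbhs_pinfty_ge; rewrite num_real.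
Unshelve. all: by end_near.
Qed.
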